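(* Let $G$ be a Polish group and $X$ a Polish $G$-space. Let $H$ be a TSI Polish group and $Y$ a Polish $H$-space. If $(X/G,\leftrightsquigarrow)$ is generically semi-connected, then the orbit equivalence relation $E^G_X$ is generically $E^H_Y$-ergodic.
   Context: A Polish group is TSI if it admits a compatible metric $d$ which is two-side invariant: $d(gh,gh')=d(h,h')=d(hg,h'g)$ for all $g,h,h'$. A Polish $G$-space is a Polish space $X$ with a continuous left action of the Polish group $G$; $[x]=Gx$ denotes the orbit of $x$, and $E^G_X$ is the orbit equivalence relation: $x\,E^G_X\,y\iff [x]=[y]$. For $x,y\in X$ write $x\leftrightsquigarrow y$ if for every open neighborhood $V$ of the identity of $G$ and every open $U\subseteq X$ having nonempty intersection with the orbit of $x$ or with the orbit of $y$, there exist $g^x,g^y\in G$ with $g^xx\in U$ and $g^yy\in U$ such that $g^yy\in\overline{V(g^xx)}$ and $g^xx\in\overline{V(g^yy)}$. This relation is symmetric and invariant under the action in each variable, so one writes $[x]\leftrightsquigarrow[y]$ when $x\leftrightsquigarrow y$. For a $G$-invariant $C\subseteq X$, let $C/G=\{[x]: x\in C\}$; the unbalanced graph of $C$ is $(C/G,\leftrightsquigarrow)$. A path in $C/G$ from $[x]$ to $[y]$ is a sequence $x_0,\dots,x_{n-1}\in C$ with $x_0=x$, $x_{n-1}=y$ and $x_{i-1}\leftrightsquigarrow x_i$ for all $0<i<n$. $(X/G,\leftrightsquigarrow)$ is generically semi-connected if for every $G$-invariant comeager $C\subseteq X$ there is a comeager $D\subseteq C$ such that for all $x,y\in D$ there is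 a path between $[x]$ and $[y]$ in $(C/G,\leftrightsquigarrow)$. For equivalence relations $E$ on $X$ and $F$ on $Y$ ($X,Y$ Polish), a Baire-measurable homomorphism from $E$ to $F$ is a Baire-measurable $f:X\to Y$ with $x\,E\,x'\Rightarrow f(x)\,F\,f(x')$. $E$ is generically $F$-ergodic if for every Baire-measurable homomorphism $f$ from $E$ to $F$ there is a comeager $C\subseteq X$ such that $f(x)\,F\,f(x')$ for all $x,x'\in C$. *)

(* Defs.v *)
From HB Require Import structures.
From mathcomp Require Import all_boot all_order all_algebra.
From mathcomp Require Import boolp classical_sets functions cardinality reals.
From mathcomp Require Import topology.

Set Implicit Arguments.
Unset Strict Implicit.
Unset Printing Implicit Defensive.

Import Order.TTheory GRing.Theory Num.Theory.

Local Open Scope classical_set_scope.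
Local Open Scope ring_scope.

Section polish_spaces.
Context {R : realType} {T : topologicalType}.
Implicit Type d : T -> T -> R.

Record is_metric d : Prop := IsMetric {
  is_metric_ge0 : forall x y, 0 <= d x y ;
  is_metric_eq0 : forall x y, d x y = 0 <-> x = y ;
  is_metric_sym : forall x y, d x y = d y x ;
  is_metric_triangle : forall x y z, d x z <= d x y + d y z
}.

(* [d] is a metric on [T] inducing the given topology of [T] *)
Definition compatible_metric d :=
  is_metric d /\
  forall (x : T) (A : set T),
    nbhs x A <-> exists2 e : R, 0 < e & [set y | d x y < e] `<=` A.

Definition cauchy_sequence d (u : nat -> T) :=
  forall e : R, 0 < e ->
    exists N, forall m n, (N <= m)%N -> (N <= n)%N -> d (u m) (u n) < e.

Definition complete_metric d :=
  forall u : nat -> T, cauchy_sequence d u -> exists l : T, u @ \oo --> l.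

End polish_spaces.

Definition separable (T : topologicalType) :=
  exists2 D : set T, countable D & dense D.

Definition polish (R : realType) (T : topologicalType) :=
  separable T /\
  exists2 d : T -> T -> R, compatible_metric d & complete_metric d.

Section baire_category.
Context {T : topologicalType}.
Implicit Type A : set T.

Definition nowhere_dense A := (closure A)° = set0.

Definition meager A :=
  exists2 F : nat -> set T,
    (forall n, nowhere_dense (F n)) & A = \bigcup_n F n.

Definition comeager A := meager (~` A).

Definition baire_property A :=
  exists2 U : set T, open U & meager ((A `\` U) `|` (U `\` A)).

End baire_category.

Definition baire_measurable (X Y : topologicalType) (f : X -> Y) :=
  forall U : set Y, open U -> baire_property (f @^-1` U).

HB.mixin Record Group_isTopologicalGroup G & Group G & Topological G := {
  mulg_continuous : continuous (fun gh : G * G => (gh.1 * gh.2)%g) ;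
  invg_continuous : continuous (fun g : G => g^-1%g)
}.

#[short(type="topologicalGroupType")]
HB.structure Definition TopologicalGroup :=
  {G of Group G & Topological G & Group_isTopologicalGroup G}.

Definition tsi (R : realType) (G : topologicalGroupType) :=
  exists2 d : G -> G -> R, compatible_metric d &
    forall g h h' : G,
      d (g * h)%g (g * h')%g = d h h' /\ d (h * g)%g (h' * g)%g = d h h'.

Record continuous_action (G : topologicalGroupType) (X : topologicalType)
    (act : G -> X -> X) : Prop := ContinuousAction {
  cact1 : forall x, act 1%g x = x ;
  cactM : forall g h x, act (g * h)%g x = act g (act h x) ;
  cact_continuous : continuous (fun gx : G * X => act gx.1 gx.2)
}.

Section unbalanced_graph.
Context {G : topologicalGroupType} {X : topologicalType}.
Variable act : G -> X -> X.
Implicit Types (x y : X) (C : set X).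

Definition gorbit x : set X := [set act g x | g in [set: G]].

Definition orbit_eqrel x y : Prop := gorbit x = gorbit y.

Definition invariant_set C := forall g x, C x -> C (act g x).

Definition unbalanced x y :=
  forall (V : set G) (U : set X),
    open_nbhs 1%g V -> open U ->
    U `&` gorbit x !=set0 \/ U `&` gorbit y !=set0 ->
    exists gx gy : G,
      [/\ U (act gx x), U (act gy y),
          closure [set act v (act gx x) | v in V] (act gy y) &
          closure [set act v (act gy y) | v in V] (act gx x)].

(* [p 0, ..., p n.-1] is a path; only the first [n] values of [p] matter.     *)
(* Vertices of the graph on [C / G] are given by representatives in [C].      *)
Definition unbalanced_path C x y :=
  exists (n : nat) (p : nat -> X),
    [/\ (0 < n)%N, p 0%N = x, p n.-1 = y,
        forall i, (i < n)%N -> C (p i) &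
        forall i, (0 < i < n)%N -> unbalanced (p i.-1) (p i)].

Definition generically_semi_connected :=
  forall C, invariant_set C -> comeager C ->
    exists D : set X,
      [/\ comeager D, D `<=` C &
          forall x y, D x -> D y -> unbalanced_path C x y].

End unbalanced_graph.

Definition homomorphism (X Y : Type) (E : X -> X -> Prop) (F : Y -> Y -> Prop)
    (f : X -> Y) :=
  forall x x', E x x' -> F (f x) (f x').

Definition generically_ergodic (X Y : topologicalType)
    (E : X -> X -> Prop) (F : Y -> Y -> Prop) :=
  forall f : X -> Y, baire_measurable f -> homomorphism E F f ->
    exists2 C : set X, comeager C & forall x x', C x -> C x' -> F (f x) (f x').

(* Main.v *)
Require Import Defs.
From HB Require Import structures.
From mathcomp Require Import all_boot all_order all_algebra.
From mathcomp Require Import boolp classical_sets functions cardinality reals.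
From mathcomp Require Import topology.
From mathcomp Require Import lra.

(** Let [f] be a Baire-measurable homomorphism, and let [V n] be a base of
conjugation-invariant identity neighbourhoods of [H]. One would like to show
that unbalanced points [x] and [y] of a suitable comeager set have [f x] and
[f y] in one orbit. What the definition gives directly is weaker: translates
of [f x] and [f y] by which small elements of [H] bring either one arbitrarily
close to the other, for each size separately. For a TSI group this relation can
be strictly coarser than the orbit relation, and it has to be iterated as in a
Scott analysis: the small moves should not only bring [y'] close to [y] but
also preserve the relation itself, at any finer precision. The derivative
[derived S] of a family [S n] of relations on [Y] expresses this requirement.
It is applied to families ([entourages]) that form a base of an invariant
uniformity and behave well with respect to category.

No ordinals occur. Because [X] is second countable, a class of such families
that is closed under derivation and countable intersections contains one that
is stable at [f x] for generic [x], in the sense that its derivative gives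
nothing new on the orbit of [f x] ([stabilization]). At such a point the
back-and-forth construction converges, by completeness of [H] in its invariant
metric ([invariant_base_complete]), and so the family controls the true
distance along the orbit ([stable_close]).

This is used twice. For the class of all families it provides a relation that
has the Baire property by construction, in place of the analytic relation that
[f (g x)] is in [V n (f x)]; the Kuratowski-Ulam theorem then yields [orbit_continuity]: near a
generic point, most small elements of [G] move [f x] by small elements of [H].
The second class consists of the families for which [f] is generically ergodic
at each finite precision ([ergodic_for]). It is closed under derivation and
countable intersections because unbalanced points have close translates for the
derived families ([unbalanced_derived_all]), and because semi-connectedness
joins generic points by paths ([ergodic_derived_all]). A stable family of this
second class shows that generic [f x] and [f x'] lie in the same orbit
([generic_orbit]). *)

Set Implicit Arguments.
Unset Strict Implicit.
Unset Printing Implicit Defensive.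

Import Order.TTheory GRing.Theory Num.Theory.

Local Open Scope classical_set_scope.


(** * Baire category *)

Section category.
Context {T : topologicalType}.
Implicit Types A B C U O : set T.

Lemma nowhere_denseP A : nowhere_dense A <-> dense (~` closure A).
Proof.
split=> [A0 O [x Ox] oO|dA].
  apply: contrapT => OA; suff: (closure A)° x by rewrite A0.
  rewrite /interior nbhsE; exists O => // y Oy.
  by apply: contrapT => nAy; apply: OA; exists y.
apply/seteqP; split=> // x; rewrite /interior /= nbhsE => -[O [oO Ox] OA].
have [|y [Oy]] := dA O _ oO; first by exists x.
by apply; apply: OA.
Qed.

Lemma comeagerP C : comeager C <->
  exists2 O : nat -> set T, (forall n, open (O n) /\ dense (O n)) &
    \bigcap_n O n `<=` C.
Proof.
split=> [[F F0 CF]|[O odO OC]].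
  exists (fun n => ~` closure (F n)) => [n|x Ox].
    by split; [exact/closed_openC/closed_closure|exact/nowhere_denseP/F0].
  apply: contrapT => nCx; have : (~` C) x by [].
  by rewrite CF => -[n _ Fx]; apply: (Ox n I); apply: subset_closure.
exists (fun n => ~` C `\` O n) => [n|].
  apply/nowhere_denseP => U U0 oU; have [oO dO] := odO n.
  have [x [Ux Ox]] := dO U U0 oU; exists x; split => // clx.
  by have [|y [[_ nOy] Oy]] := clx (O n); [exact: open_nbhs_nbhs|].
apply/seteqP; split=> [x nCx|x [n _ [nCx _]]]; last exact: nCx.
apply: contrapT => nx; apply: (nCx); apply: OC => n _.
by apply: contrapT => nO; apply: nx; exists n.
Qed.

Lemma comeagerS C C' : C `<=` C' -> comeager C -> comeager C'.
Proof.
by move=> CC /comeagerP[O odO OC]; apply/comeagerP; exists O => // x /OC /CC.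
Qed.

Lemma comeager_open C : open C -> dense C -> comeager C.
Proof. by move=> oC dC; apply/comeagerP; exists (fun=> C) => // x /(_ 0%N I). Qed.

Lemma comeagerT : comeager [set: T].
Proof. by apply: comeager_open => [|O [x Ox] _]; [exact: openT|exists x]. Qed.

Lemma comeager_all C : (forall x, C x) -> comeager C.
Proof. by move=> Cx; apply: comeagerS comeagerT => x _. Qed.

Lemma comeager_forall (J : countType) (C : J -> set T) :
  (forall i, comeager (C i)) -> comeager [set x | forall i, C i x].
Proof.
move=> Cc; have /choice[O OP] i : exists O : nat -> set T,
    (forall n, open (O n) /\ dense (O n)) /\ \bigcap_n O n `<=` C i.
  by have /comeagerP[O] := Cc i; exists O.
apply/comeagerP; exists (fun n => if unpickle n is Some (i, j) then O i j
                            else setT).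
  move=> n; case: (unpickle n) => [[i j]|]; first exact: (OP i).1.
  by split=> [|U [x Ux] _]; [exact: openT|exists x].
move=> x Ox i; apply: (OP i).2 => j _.
by have := Ox (pickle (i, j)) I; rewrite pickleK.
Qed.

Lemma comeagerI C C' : comeager C -> comeager C' -> comeager (C `&` C').
Proof.
move=> c c'; have := @comeager_forall bool (fun b => if b then C else C').
move=> H; apply: comeagerS (H _) => [x Cx|[]//].
by split; [exact: Cx true|exact: Cx false].
Qed.

Lemma comeager2 C C' D : comeager C -> comeager C' ->
  (forall x, C x -> C' x -> D x) -> comeager D.
Proof. by move=> c c' CD; apply: comeagerS (comeagerI c c') => x []; exact: CD. Qed.

(** Adding the points outside the closure of [O] to [C] gives a dense open set
of the whole space. *)
Lemma comeager_imp_open C O : open O -> open C ->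
  (forall U, open U -> U !=set0 -> U `<=` O -> U `&` C !=set0) ->
  comeager [set x | O x -> C x].
Proof.
move=> oO oC OC; pose D := C `|` ~` closure O.
suff cD : comeager D.
  by apply: comeagerS cD => x [Cx|nO] Ox //; case: nO; exact: subset_closure.
apply: comeager_open.
  by apply: openU => //; exact/closed_openC/closed_closure.
move=> U U0 oU; have [[x [Ux Ox]]|UO] := pselect (U `&` O !=set0).
  have [|||y [[Uy _] Cy]] := OC (U `&` O); [exact: openI|by exists x|by move=> ? []|].
  by exists y; split => //; left.
case: U0 => x Ux; exists x; split => //; right => clx; apply: UO.
have [|y [Oy Uy]] := clx U; first exact: open_nbhs_nbhs.
by exists y.
Qed.

(** The working form of the Baire property: agreement with an open set at
generic points. *)
Lemma baire_propertyP A : baire_property A <->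
  exists2 U, open U & comeager [set x | A x <-> U x].
Proof.
have e U : (A `\` U) `|` (U `\` A) = ~` [set x | A x <-> U x].
  apply/seteqP; split=> x; first by case=> -[a b] [] *; tauto.
  move=> /= nAU; apply: contrapT => h; apply: nAU.
  by split=> a; apply: contrapT => b; apply: h; [left|right].
by split=> -[U oU mU]; exists U => //; move: mU; rewrite e.
Qed.

Lemma bp_open O : open O -> baire_property O.
Proof. by move=> oO; apply/baire_propertyP; exists O => //; apply: comeager_all. Qed.

Lemma bp_setC A : baire_property A -> baire_property (~` A).
Proof.
move=> /baire_propertyP[U oU cU]; apply/baire_propertyP.
exists (~` closure U); first exact/closed_openC/closed_closure.
have : comeager [set x | ~ closure U x \/ U x].
  have oc : open (~` closure U) by exact/closed_openC/closed_closure.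
  apply: comeager_open; first exact: openU.
  move=> V [x Vx] oV; have [[y [Uy Vy]]|nUV] := pselect (U `&` V !=set0).
    by exists y; split=> //; right.
  exists x; split=> //; left => clx; apply: nUV; apply: clx.
  exact: open_nbhs_nbhs.
move=> /(comeager2 cU); apply => x /= AU clU; split.
  by move=> nA; case: clU => // Ux; case: nA; exact/AU.
by move=> ncl /AU Ux; apply: ncl; exact: subset_closure.
Qed.

Lemma bp_exists (I : countType) (A : I -> set T) :
  (forall i, baire_property (A i)) -> baire_property [set x | exists i, A i x].
Proof.
move=> bA; have /choice[U UP] i : exists U, open U /\ comeager [set x | A i x <-> U x].
  by have /baire_propertyP[U] := bA i; exists U.
apply/baire_propertyP; exists (\bigcup_i U i).
  by apply: bigcup_open => i _; have [] := UP i.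
apply: comeagerS (comeager_forall (fun i => (UP i).2)) => x /= h; split.
  by move=> [i /h]; exists i.
by move=> [i _ /h]; exists i.
Qed.

Lemma bp_eq A A' : (forall x, A x <-> A' x) -> baire_property A -> baire_property A'.
Proof. by move=> AA bA; rewrite (_ : A' = A) //; apply/seteqP; split=> x /AA. Qed.

Lemma bp_forall (I : countType) (A : I -> set T) :
  (forall i, baire_property (A i)) -> baire_property [set x | forall i, A i x].
Proof.
move=> bA; apply: bp_eq (bp_setC (bp_exists (fun i => bp_setC (bA i)))) => x.
split=> [nA i|Ax [i]]; last by apply.
by apply: contrapT => nAi; apply: nA; exists i.
Qed.

Lemma bp_and A A' : baire_property A -> baire_property A' ->
  baire_property [set x | A x /\ A' x].
Proof.
move=> bA bA'; have := @bp_forall bool (fun b => if b then A else A').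
move=> H; apply: bp_eq (H _) => [x|[]//].
by split=> [h|[Ax A'x] []//]; split; [exact: h true|exact: h false].
Qed.

Lemma bp_imp A A' : baire_property A -> baire_property A' ->
  baire_property [set x | A x -> A' x].
Proof.
move=> bA /bp_setC bA'; apply: bp_eq (bp_setC (bp_and bA bA')) => x; split.
  by move=> nAA Ax; apply: contrapT => nA'; apply: nAA.
by move=> AA' [/AA'].
Qed.

Lemma bp_cst (P : Prop) : baire_property [set _ : T | P].
Proof.
have [p|np] := pselect P; [apply: (bp_eq _ (bp_open openT))|
  apply: (bp_eq _ (bp_open open0))] => x; by split.
Qed.

(** Countably many sets with the Baire property become open at once after
discarding a meager set: the category version of refining the topology. *)
Lemma bp_relatively_open (I : countType) (A : I -> set T) :
  (forall i, baire_property (A i)) ->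
  exists2 C, comeager C &
    forall i, exists2 U, open U & forall x, C x -> (A i x <-> U x).
Proof.
move=> bA; have /choice[U UP] i : exists U, open U /\ comeager [set x | A i x <-> U x].
  by have /baire_propertyP[U] := bA i; exists U.
exists [set x | forall i, A i x <-> U i x].
  by apply: comeager_forall => i; have [] := UP i.
by move=> i; exists (U i); [have [] := UP i|move=> x; exact].
Qed.

Definition countable_base (B : nat -> set T) :=
  (forall i, open (B i)) /\
  forall O x, open O -> O x -> exists2 i, B i x & B i `<=` O.

Definition baire_space := forall C : set T, comeager C -> dense C.

Lemma baire_spaceP C O : baire_space -> comeager C -> open O -> O !=set0 ->
  exists2 x, O x & C x.
Proof. by move=> bT cC oO O0; have [x [? ?]] := bT _ cC O O0 oO; exists x. Qed.

End category.
Arguments countable_base : clear implicits.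
Arguments baire_space : clear implicits.

Section measurable.
Context {X Y : topologicalType}.
Context {B : nat -> set Y} (Bb : countable_base Y B).

Lemma bm_base (f : X -> Y) :
  (forall i, baire_property (f @^-1` B i)) -> baire_measurable f.
Proof.
move=> bf U oU; apply: (bp_eq (A := [set x | exists i, B i `<=` U /\ B i (f x)])).
  move=> x; split=> [[i [+ Bx]]|]; first exact.
  by move=> /(Bb.2 _ _ oU)[i]; exists i.
by apply: bp_exists => i; apply: bp_and; [exact: bp_cst|exact: bf].
Qed.

Lemma bm_cst (y : Y) : baire_measurable (fun _ : X => y).
Proof. by move=> U oU; apply: bp_cst. Qed.

Lemma bm_comp (Z : topologicalType) (g : Y -> Z) (f : X -> Y) :
  continuous g -> baire_measurable f -> baire_measurable (g \o f).
Proof. by move=> /continuousP cg bf U /cg; apply: bf. Qed.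

End measurable.

Section product.
Context {A B : topologicalType}.

Lemma open_prodP (O : set (A * B)) a b : open O -> O (a, b) ->
  exists U V, [/\ open U, open V, U a, V b & forall x y, U x -> V y -> O (x, y)].
Proof.
move=> oO Oab; have : nbhs (a, b) O by exact: open_nbhs_nbhs.
case=> -[P Q] /= [+ +] PQ; rewrite !nbhsE => -[U [oU Ua] UP] [V [oV Vb] VQ].
by exists U, V; split=> // x y /UP Px /VQ Qy; apply: PQ; split.
Qed.

Lemma open_setM (U : set A) (V : set B) : open U -> open V -> open (U `*` V).
Proof.
move=> oU oV; rewrite openE => -[a b] /= [Ua Vb]; rewrite /interior /=.
by exists (U, V) => //=; split; exact: open_nbhs_nbhs.
Qed.

Lemma open_section1 (O : set (A * B)) b : open O -> open [set a | O (a, b)].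
Proof.
move=> oO; rewrite openE => a /= Oab; rewrite /interior /= nbhsE.
have [U [V [oU oV Ua Vb UV]]] := open_prodP oO Oab.
by exists U => // x Ux; apply: UV.
Qed.

Lemma open_section2 (O : set (A * B)) a : open O -> open [set b | O (a, b)].
Proof.
move=> oO; rewrite openE => b /= Oab; rewrite /interior /= nbhsE.
have [U [V [oU oV Ua Vb UV]]] := open_prodP oO Oab.
by exists V => // x Vx; apply: UV.
Qed.

Lemma open_proj2 (O : set (A * B)) (U : set A) : open O ->
  open [set b | exists2 a, U a & O (a, b)].
Proof.
move=> oO; rewrite (_ : mkset _ = \bigcup_(a in U) [set b | O (a, b)]); last first.
  by apply/seteqP; split=> b [a]; exists a.
by apply: bigcup_open => a _; apply: open_section2.
Qed.

(** The half of the Kuratowski-Ulam theorem that needs no Baire property. For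
[O] dense open and [U] basic open, the points [b] whose section of [O] meets
[U] form a dense open set, being the projection of an open set. *)
Lemma kuratowski_ulam (Ba : nat -> set A) (W : set (A * B)) :
  countable_base A Ba -> comeager W ->
  comeager [set b | comeager [set a | W (a, b)]].
Proof.
move=> Bab /comeagerP[O odO OW].
pose D (p : nat * nat) := [set b | Ba p.2 !=set0 -> exists2 a, Ba p.2 a & O p.1 (a, b)].
apply: (@comeagerS _ [set b | forall p, D p b]).
  move=> b Db; apply/comeagerP; exists (fun n => [set a | O n (a, b)]).
    move=> n; split; first by apply: open_section1; have [] := odO n.
    move=> U [a Ua] oU; have [i Bia BU] := Bab.2 U a oU Ua.
    have [|a' /BU Ua' Oa'] := Db (n, i); first by exists a.
    by exists a'.
  by move=> a Oa; apply: OW => k _; exact: (Oa k).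
apply: comeager_forall => -[n i]; rewrite /D /=.
have [B0|B0] := pselect (Ba i !=set0); last by apply: comeager_all => b /B0.
suff : comeager [set b | exists2 a, Ba i a & O n (a, b)].
  by apply: comeagerS => b Db _.
have [oO dO] := odO n; apply: comeager_open; first exact: open_proj2.
case: B0 => a Bia V [b Vb] oV; have [||[x y] [[/= Bx Vy] Oxy]] := dO (Ba i `*` V).
- by exists (a, b).
- by apply: open_setM; [exact: Bab.1|].
- by exists y; split => //; exists x.
Qed.

End product.

(** * Metrics and Polish spaces *)

Definition tends (T : topologicalType) (u : nat -> T) (l : T) :=
  forall U : set T, open U -> U l -> exists N, forall n, (N <= n)%N -> U (u n).

Lemma cvg_tends (T : topologicalType) (u : nat -> T) (l : T) :
  u @ \oo --> l -> tends u l.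
Proof.
move=> ul U oU Ul; have : (u @ \oo) U by apply: ul; exact: open_nbhs_nbhs.
by case=> N _ NU; exists N => n /NU.
Qed.

Section metric.
Context {R : realType} {T : topologicalType}.
Local Open Scope ring_scope.

Lemma half_pow_small (e : R) : 0 < e -> exists N, forall n, (N <= n)%N -> 2^-1 ^+ n < e.
Proof.
move=> e0; exists (Num.truncn e^-1) => n Nn.
have h : e^-1 < n.+1%:R.
  apply: lt_le_trans (truncnS_gt _) _.
  by rewrite ler_nat ltnS.
rewrite exprVn invf_plt ?posrE ?exprn_gt0 //; apply: lt_le_trans h _.
by rewrite -natrX ler_nat; apply: ltn_expl.
Qed.

Lemma half_pow_gt0 n : 0 < (2^-1 : R) ^+ n.
Proof. by rewrite exprn_gt0 // invr_gt0. Qed.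

Context {d : T -> T -> R}.
Context (dP : compatible_metric d).
Let dm : is_metric d := dP.1.

Lemma metric_refl x : d x x = 0.
Proof. exact/(is_metric_eq0 dm). Qed.

Lemma ball_open x e : open [set y | d x y < e].
Proof.
rewrite openE => y /= dy; rewrite /interior /=; apply/dP.2.
exists (e - d x y); first by rewrite subr_gt0.
by move=> z /= yz; have := is_metric_triangle dm x y z; lra.
Qed.

Lemma open_ball (O : set T) x : open O -> O x ->
  exists2 e, 0 < e & [set y | d x y < e] `<=` O.
Proof. by move=> oO Ox; apply/dP.2; exact: open_nbhs_nbhs. Qed.

Lemma tends_unique (u : nat -> T) l l' : tends u l -> tends u l' -> l = l'.
Proof.
move=> ul ul'; apply/(is_metric_eq0 dm)/eqP; rewrite eq_le (is_metric_ge0 dm) andbT.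
rewrite leNgt; apply/negP => d0.
have e0 : 0 < d l l' / 2 by lra.
have [||N Nl] := ul [set y | d l y < d l l' / 2];
  [exact: ball_open|by rewrite /= metric_refl|].
have [||N' Nl'] := ul' [set y | d l' y < d l l' / 2];
  [exact: ball_open|by rewrite /= metric_refl|].
have := Nl (maxn N N') (leq_maxl _ _); have := Nl' (maxn N N') (leq_maxr _ _).
move: (u _) => z /=; have := is_metric_triangle dm l z l'.
by rewrite (is_metric_sym dm z l'); lra.
Qed.

(** A sequence of neighbourhoods forcing convergence, so that the constructions
below need not mention a metric. *)
Lemma neighbourhood_sequence y : exists U : nat -> set T,
  (forall n, open (U n) /\ U n y) /\
  forall u : nat -> T, (forall n, U n (u n)) -> tends u y.
Proof.
exists (fun n => [set z | d y z < 2^-1 ^+ n]); split.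
  by move=> n; split; [exact: ball_open|rewrite /= metric_refl half_pow_gt0].
move=> u uU W oW /(open_ball oW)[e e0 eW]; have [N Ne] := half_pow_small e0.
by exists N => n /Ne ne; apply: eW => /=; apply: lt_trans (uU n) ne.
Qed.

(** The Baire category theorem: shrinking closed balls, the [n]-th one inside the
[n]-th dense open set, have centres that converge to a common point. *)
Lemma complete_metric_baire : complete_metric d -> baire_space T.
Proof.
move=> dc C /comeagerP[O odO OC] W [x0 Wx0] oW.
have [e0 e00 e0W] := open_ball oW Wx0.
have /choice[s sP] (p : nat * (T * R)) : exists q : T * R, 0 < p.2.2 ->
    [/\ 0 < q.2, q.2 <= 2^-1 ^+ p.1 &
      forall z, d q.1 z <= q.2 -> d p.2.1 z < p.2.2 /\ O p.1 z].
  case: p => n [x r] /=; have [r0|] := pselect (0 < r); last by exists (x, r).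
  have [oO dO] := odO n.
  have [||y [yx Oy]] := dO [set y | d x y < r];
    [by exists x; rewrite /= metric_refl|exact: ball_open|].
  have [||e e1 eO] := @open_ball ([set y | d x y < r] `&` O n) y.
  - by apply: openI => //; exact: ball_open.
  - by split.
  have h0 : 0 < e / 2 by lra.
  (* Halving turns closed balls into subsets of open ones. *)
  exists (y, Num.min (e / 2) (2^-1 ^+ n)) => _ /=.
  split; first by rewrite lt_min h0 half_pow_gt0.
    by rewrite ge_min lexx orbT.
  move=> z; rewrite le_min => /andP[ze _]; apply: eO => /=; lra.
have [q [qz qs]] : exists q : nat -> T * R,
    q 0%N = (x0, e0 / 2) /\ forall n, q n.+1 = s (n, q n).
  by exists (fix q n := if n is m.+1 then s (m, q m) else (x0, e0 / 2)).
have q0 n : 0 < (q n).2.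
  elim: n => [|n IH]; first by rewrite qz /=; lra.
  by rewrite qs; have [] := sP (n, q n) IH.
have qS n z : d (q n.+1).1 z <= (q n.+1).2 -> d (q n).1 z < (q n).2 /\ O n z.
  by rewrite qs; have [_ _] := sP (n, q n) (q0 n); exact.
have qD n k z : d (q (n + k)%N).1 z <= (q (n + k)%N).2 -> d (q n).1 z <= (q n).2.
  elim: k => [|k IH]; first by rewrite addn0.
  by rewrite addnS => /qS[/ltW/IH].
have qd n m : (n <= m)%N -> d (q n).1 (q m).1 <= (q n).2.
  by move=> /subnKC <-; apply: (qD n (m - n)%N); rewrite metric_refl ltW.
have qr n : (q n.+1).2 <= 2^-1 ^+ n by rewrite qs; have [] := sP (n, q n) (q0 n).
have [|l /cvg_tends ql] := dc (fun n => (q n).1).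
  move=> e e1; have [|N /(_ N (leqnn _)) Ne] := @half_pow_small (e / 2); first by lra.
  exists N.+1 => m n Nm Nn /=; have := is_metric_triangle dm (q m).1 (q N.+1).1 (q n).1.
  rewrite (is_metric_sym dm (q m).1 (q N.+1).1).
  by have := qd _ _ Nm; have := qd _ _ Nn; have := qr N; lra.
have dl n : d (q n).1 l <= (q n).2.
  rewrite leNgt; apply/negP => lt.
  have [||N Nl] := ql [set y | d l y < d (q n).1 l - (q n).2];
    [exact: ball_open|by rewrite /= metric_refl subr_gt0|].
  have := Nl (maxn N n) (leq_maxl _ _); have := qd n (maxn N n) (leq_maxr _ _) => /=.
  by have := is_metric_triangle dm (q n).1 (q (maxn N n)).1 l;
    rewrite (is_metric_sym dm l); lra.
exists l; split; last by apply: OC => n _; have [] := qS n _ (dl n.+1).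
by apply: e0W => /=; have := dl 0%N; rewrite qz /=; lra.
Qed.

End metric.

Section polish.
Context {R : realType} {T : topologicalType} (pT : polish R T).

Lemma polish_baire : baire_space T.
Proof. by have [_ [d dP dc]] := pT; exact: complete_metric_baire dP dc. Qed.

Lemma polish_base : exists B, countable_base T B.
Proof.
have [[D /countable_injP[f finj] dD] [d dP _]] := pT.
pose b (p : nat * nat) := [set y | exists2 x, D x /\ f x = p.1 & (d x y < 2^-1 ^+ p.2)%R].
exists (fun n => if unpickle n is Some p then b p else set0); split.
  move=> n; case: (unpickle n) => [p|]; last exact: open0.
  rewrite /b (_ : mkset _ = \bigcup_(x in [set x | D x /\ f x = p.1])
    [set y | (d x y < 2^-1 ^+ p.2)%R]); last first.
    by apply/seteqP; split=> y [x]; exists x.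
  by apply: bigcup_open => x _; exact: ball_open.
move=> O x oO Ox; have [e e0 eO] := open_ball dP oO Ox.
have [|N /(_ N (leqnn _)) Ne] := @half_pow_small R (e / 2)%R; first by lra.
have [||z [/= xz Dz]] := dD [set y | (d x y < 2^-1 ^+ N)%R].
- by exists x; rewrite /= (metric_refl dP) half_pow_gt0.
- exact: ball_open.
exists (pickle (f z, N)).
  by rewrite pickleK; exists z => //; rewrite (is_metric_sym dP.1).
rewrite pickleK => y [z' [Dz' /finj fz]]; rewrite fz ?inE // => zy.
by apply: eO => /=; have := is_metric_triangle dP.1 x z y; rewrite /= in zy; lra.
Qed.

(** The point of [T] serves as default value for the empty sets of a base. *)
Lemma polish_dense_sequence : T -> exists q : nat -> T,
  forall O : set T, open O -> O !=set0 -> exists n, O (q n).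
Proof.
move=> x0; have [B [Bo Bb]] := polish_base.
have /choice[q qP] n : exists x, B n !=set0 -> B n x.
  by have [[x Bx]|] := pselect (B n !=set0); [exists x|exists x0].
exists q => O oO [x Ox]; have [n Bx BO] := Bb _ _ oO Ox.
by exists n; apply/BO/qP; exists x.
Qed.

End polish.

(** * Polish group actions *)

Section action.
Context {G : topologicalGroupType} {X : topologicalType} {act : G -> X -> X}.
Context (actP : continuous_action act).

Lemma act_open (U : set X) : open U -> open [set gx : G * X | U (act gx.1 gx.2)].
Proof. by move: (cact_continuous actP) => /continuousP; apply. Qed.

Lemma act_open1 (U : set X) x : open U -> open [set g | U (act g x)].
Proof. by move=> /act_open/(open_section1 x). Qed.

Lemma act_open2 (U : set X) g : open U -> open [set x | U (act g x)].
Proof. by move=> /act_open/(open_section2 g). Qed.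

Lemma act_continuous2 g : continuous (act g).
Proof. by apply/continuousP => U oU; exact: act_open2. Qed.

Lemma actK g x : act g^-1%g (act g x) = x.
Proof. by rewrite -(cactM actP) mulVg (cact1 actP). Qed.

Lemma actVK g x : act g (act g^-1%g x) = x.
Proof. by rewrite -(cactM actP) mulgV (cact1 actP). Qed.

Lemma gorbit_act g x : gorbit act (act g x) = gorbit act x.
Proof.
apply/seteqP; split=> _ [h _ <-]; first by exists (h * g)%g; rewrite ?(cactM actP).
by exists (h * g^-1)%g; rewrite // -(cactM actP) mulgVK.
Qed.

Lemma orbit_eqrelP x y : orbit_eqrel act x y <-> exists g, y = act g x.
Proof.
split=> [xy|[g ->]]; last by rewrite /orbit_eqrel gorbit_act.
have [g _ gx] : gorbit act x y by rewrite xy; exists 1%g; rewrite ?(cact1 actP).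
by exists g.
Qed.

(** The action map is continuous and open, since its restriction to each
[{g} x X] is a homeomorphism; so it pulls dense open sets back to dense open
sets. *)
Lemma comeager_act (C : set X) : comeager C ->
  comeager [set gx : G * X | C (act gx.1 gx.2)].
Proof.
move=> /comeagerP[O odO OC]; apply/comeagerP.
exists (fun n => [set gx : G * X | O n (act gx.1 gx.2)]) => [n|gx Ogx].
  have [oO dO] := odO n; split; first exact: act_open.
  move=> W [[g x] Wgx] oW.
  have [||y [Wy Oy]] := dO [set y | W (g, act g^-1%g y)].
  - by exists (act g x); rewrite /= actK.
  - exact: act_open2 (open_section2 g oW).
  by exists (g, act g^-1%g y); split; rewrite //= actVK.
by apply: OC => n _; exact: Ogx n I.
Qed.

End action.

Section group.
Context {G : topologicalGroupType}.

Lemma lmul_action : continuous_action (fun g h : G => (g * h)%g).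
Proof. by split=> [x|g h x|]; [exact: mul1g|rewrite mulgA|exact: mulg_continuous]. Qed.

Lemma mulg_open (U : set G) : open U -> open [set gh : G * G | U (gh.1 * gh.2)%g].
Proof. exact: (act_open lmul_action). Qed.

Lemma mulgr_open (U : set G) h : open U -> open [set g | U (g * h)%g].
Proof. exact: (act_open1 lmul_action). Qed.

Lemma mulgl_open (U : set G) g : open U -> open [set h | U (g * h)%g].
Proof. exact: (act_open2 lmul_action). Qed.

Lemma invg_open (U : set G) : open U -> open [set g | U g^-1%g].
Proof. by move: (@invg_continuous G) => /continuousP; apply. Qed.

Lemma comeager_mulgr (C : set G) h : comeager C -> comeager [set g | C (g * h)%g].
Proof.
move=> /comeagerP[O odO OC]; apply/comeagerP.
exists (fun n => [set g | O n (g * h)%g]) => [n|g Og]; last first.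
  by apply: OC => n _; exact: Og n I.
have [oO dO] := odO n; split; first exact: mulgr_open.
move=> W [g Wg] oW; have [||y [Wy Oy]] := dO [set y | W (y * h^-1)%g].
- by exists (g * h)%g; rewrite /= mulgK.
- exact: mulgr_open.
by exists (y * h^-1)%g; split; rewrite //= mulgVK.
Qed.

Lemma small_square (V : set G) : open V -> V 1%g ->
  exists W : set G, [/\ open W, W 1%g & forall g h, W g -> W h -> V (g * h)%g].
Proof.
move=> /mulg_open oV V1.
have [|A [B [oA oB A1 B1 AB]]] := open_prodP oV (a := 1%g) (b := 1%g).
  by rewrite /= mul1g.
exists (A `&` B); split; [exact: openI|by []|].
by move=> g h [Ag _] [_ Bh]; exact: AB.
Qed.

(** The identity neighbourhoods that a two-sided invariant metric provides, with
the metric forgotten: [V n] stands for the ball of radius [2^-n]. *)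
Record invariant_base (V : nat -> set G) : Prop := InvariantBase {
  ib_open : forall n, open (V n) ;
  ib_1 : forall n, V n 1%g ;
  ib_inv : forall n g, V n g -> V n g^-1%g ;
  ib_conj : forall n g h, V n h -> V n (g * h * g^-1)%g ;
  ib_mul : forall n g h, V n.+1 g -> V n.+1 h -> V n (g * h)%g ;
  ib_base : forall U, open U -> U 1%g -> exists n, V n `<=` U
}.

Lemma tsi_invariant_base (R : realType) : tsi R G -> exists V, invariant_base V.
Proof.
move=> [d dP dinv]; have dm := dP.1.
have dl g h h' : d (g * h)%g (g * h')%g = d h h' by have [] := dinv g h h'.
have dr g h h' : d (h * g)%g (h' * g)%g = d h h' by have [] := dinv g h h'.
exists (fun n => [set g | d 1%g g < 2^-1 ^+ n]%R); split.
- by move=> n; exact: ball_open.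
- by move=> n /=; rewrite (metric_refl dP) half_pow_gt0.
- by move=> n g /=; have := dl g 1%g g^-1%g; rewrite mulg1 mulgV (is_metric_sym dm) => ->.
- move=> n g h /=; have := dr g 1%g (g * h * g^-1)%g.
  by rewrite mul1g mulgVK -{1}[g]mulg1 dl => ->.
- move=> n g h /= gV hV; have := is_metric_triangle dm 1%g g (g * h)%g.
  rewrite -{3}[g]mulg1 dl; move: gV hV; rewrite !exprS; lra.
- move=> U oU U1; have [e e0 eU] := open_ball dP oU U1.
  have [N Ne] := half_pow_small e0; exists N => g /= gN; apply: eU => /=.
  exact: lt_trans gN (Ne _ _).
Qed.

Lemma ib_mono V m n : invariant_base V -> (m <= n)%N -> V n `<=` V m.
Proof.
move=> VP /subnKC <-; elim: (n - m)%N => [|k IH]; first by rewrite addn0.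
move=> g; rewrite addnS => Vg; apply: IH; rewrite -[g]mulg1.
by apply: (ib_mul VP) => //; exact: (ib_1 VP).
Qed.

Lemma ib_conjV V n g h : invariant_base V -> V n (g * h)%g -> V n (h * g)%g.
Proof. by move=> VP /(ib_conj VP h); rewrite mulgA mulgK. Qed.

(** An invariant metric of a Polish group is complete, although completeness is
assumed of some other compatible metric [d] only. If [u] is Cauchy for the
invariant base, then for generic [k] the sequence [u n * k] is Cauchy for [d]:
near any [k0] there is [k] such that [u n * k] is eventually as close as
desired to one fixed point [u N * k0]. A limit of [u n * k], translated back by
[k^-1], is a limit of [u]. *)
Lemma invariant_base_complete (R : realType) V (u : nat -> G) :
  polish R G -> invariant_base V ->
  (forall m, exists N, forall n n', (N <= n)%N -> (N <= n')%N ->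
     V m (u n * (u n')^-1)%g) ->
  exists l, tends u l.
Proof.
move=> pG VP uV; have bG := polish_baire pG; have [_ [d dP dc]] := pG.
have dm := dP.1.
pose P m (K : set G) := open K /\ exists N, forall n n' k, K k -> (N <= n)%N -> (N <= n')%N ->
  (d (u n * k)%g (u n' * k)%g < 2^-1 ^+ m)%R.
pose O m := \bigcup_(K in P m) K.
have cO : comeager [set k | forall m, O m k].
  apply: comeager_forall => m; apply: comeager_open.
    by apply: bigcup_open => K PK; have [] := PK.
  move=> U [k0 Uk0] oU.
  have [||m1 m1U] := ib_base VP (U := [set v | U (v * k0)%g]);
    [exact: mulgr_open|by rewrite /= mul1g|].
  have [N NP] := uV m1; pose z := (u N * k0)%g.
  have [||m2 m2U] := ib_base VP (U := [set v | d z (v * z)%g < 2^-1 ^+ m.+1]%R).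
  - exact: (mulgr_open z (ball_open dP z _)).
  - by rewrite /= mul1g (metric_refl dP) half_pow_gt0.
  have [N2 NP2] := uV m2.+1; pose M := maxn N N2.
  exists ((u M)^-1 * z)%g; split.
    rewrite /z mulgA; apply: (m1U ((u M)^-1 * u N)%g); apply: (ib_conjV VP).
    by apply: NP => //; exact: leq_maxl.
  exists [set k | V m2.+1 (u M * k * z^-1)%g]; last first.
    by rewrite /= mulVKg mulgV; exact: (ib_1 VP).
  split.
    have oV := ib_open VP m2.+1.
    exact: (mulgl_open (U := [set h | V m2.+1 (h * z^-1)%g]) _ (mulgr_open _ oV)).
  have near n k : V m2.+1 (u M * k * z^-1)%g -> (M <= n)%N ->
      (d z (u n * k)%g < 2^-1 ^+ m.+1)%R.
    move=> Vk Mn; have -> : (u n * k)%g = (u n * (u M)^-1 * (u M * k * z^-1) * z)%g.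
      by rewrite -!mulgA mulVg mulg1 mulKg.
    apply: m2U; apply: (ib_mul VP) => //; apply: NP2; last exact: leq_maxr.
    by apply: leq_trans Mn; exact: leq_maxr.
  exists M => n n' k Vk Mn Mn'; have := near n k Vk Mn; have := near n' k Vk Mn'.
  have := is_metric_triangle dm (u n * k)%g z (u n' * k)%g.
  by rewrite (is_metric_sym dm _ z) exprS; lra.
have [|k _ kO] := baire_spaceP bG cO (openT); first by exists 1%g.
have [|l /cvg_tends ul] := dc (fun n => u n * k)%g.
  move=> e /half_pow_small[m me]; have [K [_ [N NP]] Kk] := kO m.
  by exists N => n n' Nn Nn'; apply: lt_trans (me m (leqnn m)); exact: NP.
exists (l * k^-1)%g.
move=> U oU Ul; have [N NU] := ul _ (mulgr_open k^-1%g oU) Ul.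
by exists N => n /NU /=; rewrite mulgK.
Qed.

End group.

Section chain.
Context {H : topologicalGroupType} {Y : topologicalType} {act : H -> Y -> Y}.
Context (actP : continuous_action act).

(** Summable moves within an orbit do not leave it: the products of the moves
form a Cauchy sequence of the group. *)
Lemma chain_limit (R : realType) (V : nat -> set H) n (y_ : nat -> Y) y :
  polish R H -> polish R Y -> invariant_base V ->
  (forall k, exists2 v, V (n + k).+2 v & y_ k.+1 = act v (y_ k)) ->
  tends y_ y -> exists2 v, V n v & y = act v (y_ 0%N).
Proof.
move=> pH [_ [d dP _]] VP.
move=> yS ylim; have /choice[v vP] k : exists v, V (n + k).+2 v /\ y_ k.+1 = act v (y_ k).
  by have [v] := yS k; exists v.
have [w [w0 wS]] : exists w : nat -> H, w 0%N = 1%g /\ forall k, w k.+1 = (v k * w k)%g.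
  by exists (fix w k := if k is j.+1 then (v j * w j)%g else 1%g).
have yw k : y_ k = act (w k) (y_ 0%N).
  elim: k => [|k IH]; first by rewrite w0 (cact1 actP).
  by rewrite wS (cactM actP) -IH; have [] := vP k.
have wV j k : V (n + j).+1 (w (j + k)%N * (w j)^-1)%g.
  elim: k j => [|k IH] j; first by rewrite addn0 mulgV; exact: (ib_1 VP).
  rewrite addnS -addSn.
  have -> : (w (j.+1 + k) * (w j)^-1 = (w (j.+1 + k) * (w j.+1)^-1) * v j)%g.
    by rewrite wS -mulgA invgM mulgVK.
  by apply: (ib_mul VP); [rewrite -addnS; exact: IH|have [] := vP j].
have [m|l lw] := invariant_base_complete pH VP (u := w).
  exists m => k k' mk mk'; apply: (ib_mono VP (leq_addl n m)).
  rewrite -[w k](mulgVK (w m)) -mulgA -[(_ * (w k')^-1)%g]invgK invgM invgK.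
  apply: (ib_mul VP); first by rewrite -(subnKC mk); exact: wV.
  by apply: (ib_inv VP); rewrite -(subnKC mk'); exact: wV.
have yl : tends y_ (act l (y_ 0%N)).
  move=> U oU Ul; have [N NU] := lw _ (act_open1 actP (y_ 0%N) oU) Ul.
  by exists N => k /NU; rewrite (yw k).
exists l; last exact: (tends_unique dP ylim yl).
have [||N /(_ N (leqnn N)) VN] := lw [set g | V n.+1 (l * g^-1)%g].
- have oV : open [set g | V n.+1 (l * g)%g] by apply: mulgl_open; exact: ib_open.
  exact: invg_open oV.
- by rewrite /= mulgV; exact: (ib_1 VP).
rewrite -[l](mulgVK (w N)); apply: (ib_mul VP) => //.
by have := wV 0%N N; rewrite addn0 w0 invg1 mulg1.
Qed.

End chain.

(** * Outer approximations of the orbit relation *)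

Lemma tends_shift (T : topologicalType) (u : nat -> T) l :
  tends (fun n => u n.+1) l -> tends u l.
Proof.
move=> ul U oU Ul; have [N NU] := ul U oU Ul.
by exists N.+1 => -[|n] // /NU.
Qed.

Section systems.
Context {H : topologicalGroupType} {Y : topologicalType} {act : H -> Y -> Y}.
Context (actP : continuous_action act).
Context {V : nat -> set H}.
Context (VP : invariant_base V).
Context {q : nat -> H}.
Context (qP : forall O : set H, open O -> O !=set0 -> exists n, O (q n)).
Context {B : nat -> set Y}.
Context (BP : countable_base Y B).

(** [S n y y'] is meant as an upper approximation of [y' \in V n y], with [n]
measuring precision. *)
Definition system := nat -> Y -> Y -> Prop.
Implicit Type S : system.

(** A base of an [H]-invariant uniformity on [Y] in which small elements of [H]
move points little; the finest one relates [y] to the points of [V n y]. The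
last clause is what makes category arguments available for [S]. For that finest
system it would amount to the theorem that analytic sets have the Baire
property; the coarser systems below have it by construction. It speaks of all
maps, in order to cover constant maps, translates of one map, and maps on a
product space. *)
Record entourages S : Prop := Entourages {
  ent_sym : forall n y y', S n y y' -> S n y' y ;
  ent_act : forall n h y y', S n y y' -> S n (act h y) (act h y') ;
  ent_near : forall n v y, V n v -> S n y (act v y) ;
  ent_trans : forall n y y' y'', S n.+1 y y' -> S n.+1 y' y'' -> S n y y'' ;
  ent_bp : forall (Z : topologicalType) (a b : Z -> Y),
    baire_measurable a -> baire_measurable b ->
    forall n, baire_property [set z | S n (a z) (b z)]
}.

(** The next step of a back-and-forth construction: an element of [V n] brings
[y'] as close to [y] as desired, both in the topology of [Y] and for [S]. *)
Definition chases S n y y' := forall m U, open U -> U y ->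
  exists v, [/\ V n v, U (act v y') & S m y (act v y')].

(** Every pair with [y' \in V n y] survives the passage from [S] to [derived S];
iterating it transfinitely would end with the orbit relation. *)
Definition derived S : system := fun n y y' =>
  [/\ S n y y', chases S n y y' & chases S n y' y].

Definition derived_all (S : nat -> system) : system := fun n y y' =>
  forall k, derived (S k) n y y'.

Lemma ent_refl S n y : entourages S -> S n y y.
Proof. by move=> gS; rewrite -{2}[y](cact1 actP); apply: ent_near => //; exact: ib_1. Qed.

Lemma ent_mono S m n y y' : entourages S -> (m <= n)%N -> S n y y' -> S m y y'.
Proof.
move=> gS /subnKC <-; elim: (n - m)%N => [|k IH]; first by rewrite addn0.
by rewrite addnS => Syy; apply: IH; apply: (ent_trans gS) Syy _; exact: ent_refl.
Qed.

(** The quantifiers over [m], [U] and [v] may be restricted to countable sets: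
basic open sets for [U], and, because [V n] is open and [S] tolerates small
moves, a dense sequence for [v]. *)
Lemma chases_bp S n (Z : topologicalType) (a b : Z -> Y) : entourages S ->
  baire_measurable a -> baire_measurable b ->
  baire_property [set z | chases S n (a z) (b z)].
Proof.
move=> gS ba bb.
pose E (mi : nat * nat) := [set z | B mi.2 (a z) -> exists j,
  V n (q j) /\ B mi.2 (act (q j) (b z)) /\ S mi.1 (a z) (act (q j) (b z))].
apply: (bp_eq (A := [set z | forall mi, E mi z])).
  move=> z; split=> [Ez m U oU Ua|ch [m i] /= Ba].
    have [i Ba BU] := BP.2 U _ oU Ua.
    by have [j [Vj [Bj Sj]]] := Ez (m, i) Ba; exists (q j); split=> //; exact: BU.
  have oB := BP.1 i; have [v [Vv Bv Sv]] := ch m.+1 _ oB Ba.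
  have [||j [[Vj Bj] Vjv]] := qP (O := (V n `&` [set h | B i (act h (b z))]) `&`
                                   [set h | V m.+1 (h * v^-1)%g]).
  - apply: openI; first by apply: openI; [exact: ib_open|exact: (act_open1 actP (b z) oB)].
    exact: (mulgr_open v^-1%g (ib_open VP m.+1)).
  - by exists v; split=> //; rewrite /= mulgV; exact: ib_1.
  exists j; split=> //; split=> //; apply: (ent_trans gS) Sv _.
  rewrite -[q j](mulgVK v) (cactM actP); exact: ent_near.
apply: bp_forall => -[m i]; apply: bp_imp; first exact: (ba _ (BP.1 i)).
apply: bp_exists => j; apply: bp_and; first exact: bp_cst.
have bqb : baire_measurable (act (q j) \o b).
  by apply: bm_comp bb; exact: act_continuous2.
by apply: bp_and; [exact: (bqb _ (BP.1 i))|exact: (ent_bp gS ba bqb)].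
Qed.

Lemma chases_act S n h y y' : entourages S -> chases S n y y' ->
  chases S n (act h y) (act h y').
Proof.
move=> gS ch m U oU Uy; have [||v [Vv Uv Sv]] := ch m [set z | U (act h z)].
- exact: (act_open2 actP h oU).
- exact: Uy.
exists (h * v * h^-1)%g; rewrite -(cactM actP) mulgVK (cactM actP).
by split; [exact: ib_conj|exact: Uv|exact: ent_act].
Qed.

Lemma chases_trans S n y y' y'' : entourages S -> chases S n.+1 y y' ->
  chases S n.+1 y' y'' -> chases S n y y''.
Proof.
move=> gS c1 c2 m U oU Uy; have [v [Vv Uv Sv]] := c1 m.+1 U oU Uy.
have [||w [Vw Uw Sw]] := c2 m.+1 [set z | U (act v z)];
  [exact: (act_open2 actP v oU)|exact: Uv|].
exists (v * w)%g; rewrite (cactM actP); split; [exact: ib_mul|exact: Uw|].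
by apply: (ent_trans gS) Sv _; exact: ent_act.
Qed.

Lemma chases_near S n v y : entourages S -> V n v -> chases S n y (act v y).
Proof.
move=> gS Vv m U oU Uy; exists v^-1%g; rewrite (actK actP).
by split=> //; [exact: ib_inv|exact: ent_refl].
Qed.

(** Derivation and countable intersection in one operation, which is all the
closure that [stabilization] asks of a class of systems. *)
Lemma entourages_derived_all (S : nat -> system) :
  (forall k, entourages (S k)) -> entourages (derived_all S).
Proof.
move=> gS; split.
- by move=> n y y' Syy k; have [] := Syy k; split=> //; exact: ent_sym.
- by move=> n h y y' Syy k; have [] := Syy k; split;
    [exact: ent_act|exact: chases_act|exact: chases_act].
- move=> n v y Vv k; split; [exact: ent_near|exact: chases_near|].
  rewrite -{2}[y](actK actP v); apply: chases_near => //; exact: ib_inv.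
- move=> n y y' y'' S1 S2 k; have [a1 b1 c1] := S1 k; have [a2 b2 c2] := S2 k.
  split; [exact: (ent_trans (gS k)) a1 a2|exact: chases_trans b1 b2|].
  exact: chases_trans c2 c1.
- move=> Z a b ba bb n.
  have h k : baire_property [set z | S k n (a z) (b z) /\
      (chases (S k) n (a z) (b z) /\ chases (S k) n (b z) (a z))].
    by apply: bp_and; [exact: ent_bp|apply: bp_and; exact: chases_bp].
  apply: bp_eq (bp_forall h) => z; split=> Sz k; first by have [? []] := Sz k.
  by have [] := Sz k.
Qed.

(** [S] agrees, up to a shift of the precision, with its derivative on pairs of
points of the orbit of [y]. *)
Definition stable_at S y := forall n h,
  S n.+2 y (act h y) -> derived S n y (act h y).

(** In place of a transfinite iteration: the systems of the class [K] decrease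
under derivation, and modulo meager sets the sets [S n (f x) (q j (f x))] have
only countably many chances to decrease, one for each basic open set on which
they may become meager. Intersecting witnesses for all these chances gives [S]
in [K] such that deriving it once more changes these sets by meager sets only.
The Baire property is used to find a basic open set where a nonmeager
difference is comeager. Density of the sequence [q] then passes from the [q j]
to all [h], at the cost of two units of precision. *)
Lemma stabilization (X : topologicalType) (BX : nat -> set X) (f : X -> Y)
    (K : system -> Prop) :
  baire_space X -> countable_base X BX -> baire_measurable f ->
  (forall S, K S -> entourages S) ->
  (forall S : nat -> system, (forall k, K (S k)) -> K (derived_all S)) ->
  (exists S, K S) ->
  exists2 S, K S & comeager [set x | stable_at S (f x)].
Proof.
move=> bX BXP bf Kg Kr [S0 KS0].
pose A S j n := [set x | S n (f x) (act (q j) (f x))].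
(* [Sm (i, j, n)] makes the set for [j] and [n] meager in [BX i], if any system
of [K] does. *)
have /choice[Sm SmP] (t : nat * nat * nat) : exists S, K S /\
    forall S', K S' -> comeager [set x | BX t.1.1 x -> ~ A S' t.1.2 t.2 x] ->
      comeager [set x | BX t.1.1 x -> ~ A S t.1.2 t.2 x].
  have [[S [KS cS]]|nS] := pselect (exists S, K S /\
    comeager [set x | BX t.1.1 x -> ~ A S t.1.2 t.2 x]); first by exists S.
  by exists S0; split=> // S' KS' cS'; case: nS; exists S'.
pose S := derived_all (fun k => if unpickle k is Some t then Sm t else S0).
have KS : K S.
  by apply: Kr => k; case: (unpickle k) => // t; have [] := SmP t.
have SSm t n y y' : S n y y' -> Sm t n y y'.
  by move=> /(_ (pickle t)); rewrite pickleK => -[].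
pose T := derived_all (fun=> S).
have KT : K T by exact: Kr.
have [gS gT] := (Kg _ KS, Kg _ KT).
exists S => //.
have bq j : baire_measurable (fun x => act (q j) (f x)).
  by apply: (bm_comp (f := f)) bf; exact: act_continuous2.
have cE j n : comeager [set x | A S j n x -> A T j n x].
  have /baire_propertyP[U oU cU] : baire_property [set x | A S j n x -> A T j n x].
    by apply: bp_imp; apply: ent_bp.
  suff dU : dense U.
    by apply: comeager2 cU (comeager_open oU dU) _ => x /= [_]; exact.
  move=> O [x0 Ox0] oO; have [i Bx0 BO] := BXP.2 _ _ oO Ox0.
  (* Otherwise [T] is meager in [BX i], hence so is [Sm (i, j, n)] and then [S],
  while generic points of [BX i] satisfy [S]. *)
  apply: contrapT => OU.
  have cT : comeager [set x | BX i x -> ~ A T j n x].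
    apply: comeagerS cU => x [h _] Bx AT; apply: OU; exists x.
    by split; [exact: BO|exact: h].
  have cS := (SmP (i, j, n)).2 T KT cT.
  have [|x Bx [/= eU nS]] := baire_spaceP bX (comeagerI cU cS) (BXP.1 i); first by exists x0.
  apply: OU; exists x; split; first exact: BO.
  by apply/eU => AS; case: (nS Bx); exact: SSm.
apply: comeagerS (comeager_forall (fun p : nat * nat => cE p.1 p.2)) => x.
move=> /= Ex n h Sh.
have [||j Vj] := qP (O := [set p | V n.+2 (p * h^-1)%g]).
- exact: (mulgr_open h^-1%g (ib_open VP n.+2)).
- by exists h; rewrite /= mulgV; exact: ib_1.
have Sj : S n.+1 (f x) (act (q j) (f x)).
  apply: (ent_trans gS) Sh _; rewrite -[q j](mulgVK h) (cactM actP).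
  exact: ent_near.
suff : T n (f x) (act h (f x)) by move=> /(_ 0%N).
apply: (ent_trans gT) (Ex (j, n.+1) Sj) _.
rewrite -[h](mulgVK (q j)) (cactM actP); apply: ent_near => //.
apply: (ib_mono VP (leqnSn _)).
by have := ib_inv VP Vj; rewrite invgM invgK.
Qed.

(** Where [S] is stable, it bounds the true distance along the orbit: [h y]
can be moved towards [y] by elements of [V (n + k).+2], with [S] again small
after each move, and the moves converge in [H]. *)
Lemma stable_close (R : realType) S y n h : polish R H -> polish R Y ->
  entourages S -> stable_at S y -> S n.+4 y (act h y) ->
  exists2 v, V n v & y = act v (act h y).
Proof.
move=> pH pY gS st Sh.
have [_ [d dP _]] := pY; have [U [UP Ulim]] := neighbourhood_sequence dP y.
have /choice[s sP] (p : nat * H) : exists g, S (n + p.1).+4 y (act p.2 y) ->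
    exists2 v, V (n + p.1).+2 v & g = (v * p.2)%g /\
      (U p.1 (act g y) /\ S (n + p.1).+1.+4 y (act g y)).
  case: p => k g /=; have [Sg|nS] := pselect (S (n + k).+4 y (act g y)); last by exists g.
  have [_ ch _] := st _ _ Sg; have [oU Uy] := UP k.
  have [v [Vv Uv Sv]] := ch (n + k).+1.+4 _ oU Uy.
  by exists (v * g)%g => _; exists v; rewrite // (cactM actP).
have [g [g0 gS']] : exists g : nat -> H, g 0%N = h /\ forall k, g k.+1 = s (k, g k).
  by exists (fix g k := if k is j.+1 then s (j, g j) else h).
have Sg k : S (n + k).+4 y (act (g k) y).
  elim: k => [|k IH]; first by rewrite addn0 g0.
  by rewrite gS' addnS; have [v _ [_ []]] := sP (k, g k) IH.
have := chain_limit actP (n := n) (y_ := fun k => act (g k) y) pH pY VP.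
rewrite g0; apply.
  move=> k; have [v Vv [gk _]] := sP (k, g k) (Sg k).
  by exists v; rewrite // -(cactM actP) -gk gS'.
apply: tends_shift; apply: Ulim => k.
by have [v _ [_ []]] := sP (k, g k) (Sg k); rewrite gS'.
Qed.

End systems.

(** * Orbit continuity *)

Lemma bm_act (G : topologicalGroupType) (X Y : topologicalType)
    (act : G -> X -> X) (f : X -> Y) : continuous_action act ->
  baire_measurable f -> baire_measurable (fun gx : G * X => f (act gx.1 gx.2)).
Proof.
move=> actP bf U /bf/baire_propertyP[O oO cO]; apply/baire_propertyP.
exists [set gx | O (act gx.1 gx.2)]; first exact: (act_open actP).
by apply: comeagerS (comeager_act actP cO).
Qed.

(** It makes [bm_act] apply to the second projection. *)
Lemma trivial_action (G : topologicalGroupType) (X : topologicalType) :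
  continuous_action (fun (_ : G) (x : X) => x).
Proof. by split=> // -[g x]; exact: cvg_snd. Qed.

Section orbits.
Context {G : topologicalGroupType} {X : topologicalType} {actG : G -> X -> X}.
Context (aGP : continuous_action actG).
Context {BG : nat -> set G}.
Context (BGP : countable_base G BG).
Context (bG : baire_space G).
Context {BX : nat -> set X}.
Context (BXP : countable_base X BX).
Context (bX : baire_space X).

Lemma comeager_orbit (C : set X) : comeager C ->
  comeager [set x | comeager [set g | C (actG g x)]].
Proof. by move=> /(comeager_act aGP)/(kuratowski_ulam BGP). Qed.

Lemma comeager_orbit_act (C : set X) g x : comeager [set h | C (actG h x)] ->
  comeager [set h | C (actG h (actG g x))].
Proof.
move=> /(comeager_mulgr g); apply: comeagerS => h /=.
by rewrite (cactM aGP).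
Qed.

Lemma comeager_orbitP (C : set X) x (U : set G) : comeager [set g | C (actG g x)] ->
  open U -> U !=set0 -> exists2 g, U g & C (actG g x).
Proof. exact: baire_spaceP. Qed.

Context {H : topologicalGroupType} {Y : topologicalType} {act : H -> Y -> Y}.
Context (actP : continuous_action act).
Context {V : nat -> set H}.
Context (VP : invariant_base V).
Context {q : nat -> H}.
Context (qP : forall O : set H, open O -> O !=set0 -> exists n, O (q n)).
Context {B : nat -> set Y}.
Context (BP : countable_base Y B).

Context {f : X -> Y}.
Context (bf : baire_measurable f).
Context (fP : forall g x, exists h, f (actG g x) = act h (f x)).

Lemma trivial_entourages : entourages (act := act) (V := V) (fun _ _ _ => True).
Proof. by split=> // Z a b _ _ _; exact: bp_cst. Qed.

(** The orbit map of a single [x] may pull meager sets back to nonmeager ones.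
For generic [x], however, most of the orbit lies in a comeager set on which [f]
is continuous. *)
Lemma bm_orbit : comeager [set x | baire_measurable (fun g => f (actG g x))].
Proof.
have [C cC CU] := bp_relatively_open (fun i => bf (BP.1 i)).
apply: comeagerS (comeager_orbit cC) => x cx; apply: (bm_base BP) => i.
have [U oU UP] := CU i; apply/baire_propertyP.
exists [set g | U (actG g x)]; first exact: (act_open1 aGP x oU).
by apply: comeagerS cx => g /UP.
Qed.

(** The countably many translates [V n.+1 (q p) (f x)], enlarged to sets with the
Baire property by means of [S], cover the image of the orbit of [x]. A generic
[g0] lies in the interior, modulo a meager set, of the preimage of one of them,
so [f] moves little near [g0 x] in the direction of most [g] close to [1]. *)
Lemma close_on_orbit (S : system (Y := Y)) x : entourages (act := act) (V := V) S ->
  baire_measurable (fun g => f (actG g x)) ->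
  comeager [set g0 | forall n, exists W : set G, [/\ open W, W 1%g &
    comeager [set g | W g -> S n (f (actG g0 x)) (f (actG g (actG g0 x)))]]].
Proof.
move=> gS bx.
pose A (p : nat * nat) := [set g | S p.1.+1 (act (q p.2) (f x)) (f (actG g x))].
have bA p : baire_property (A p).
  by apply: (ent_bp gS) => //; exact: bm_cst.
have [E cE EU] := bp_relatively_open bA.
apply: comeagerS (cE) => g0 Eg0 n.
have [h fh] := fP g0 x.
have [||p Vp] := qP (O := [set p | V n.+1 (p * h^-1)%g]).
- exact: (mulgr_open h^-1%g (ib_open VP n.+1)).
- by exists h; rewrite /= mulgV; exact: ib_1.
have Ag0 : A (n, p) g0.
  rewrite /A /=; apply: (ent_sym gS); rewrite fh -[q p](mulgVK h) (cactM actP).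
  exact: (ent_near gS).
have [U oU UP] := EU (n, p).
exists [set g | U (g * g0)%g]; split.
- exact: (mulgr_open g0 oU).
- by rewrite /= mul1g; apply/UP.
apply: comeagerS (comeager_mulgr g0 cE) => g /= Eg Ug.
apply: (ent_trans gS) (ent_sym gS Ag0) _.
by rewrite -(cactM aGP); apply/(UP _ Eg).
Qed.

(** Around a generic point one identity neighbourhood [W] of [G] serves all
generic points at once. The relation between [g] and [x] saying that
[f (g x)] is in [V n (f x)] is analytic; a system that is stable at generic
[f x] replaces it by one that has the Baire property by construction, hence is
an open subset of [G * X] modulo a meager set, to which the Kuratowski-Ulam
theorem applies. *)
Lemma orbit_continuity (R : realType) : polish R H -> polish R Y ->
  exists2 C, comeager C & forall n x0, C x0 -> exists U W,
    [/\ open U, U x0, open W, W 1%g & forall x, U x -> C x ->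
      comeager [set g : G | W g ->
        exists2 v, V n v & f (actG g x) = act v (f x)]].
Proof.
move=> pH pY.
have [//|||S gS cS] := stabilization actP VP qP bX BXP bf
  (K := entourages (act := act) (V := V)).
- by move=> S gS; exact: (entourages_derived_all actP VP qP BP gS).
- by exists (fun _ _ _ => True); exact: trivial_entourages.
pose Rel n := [set gx : G * X | S n (f gx.2) (f (actG gx.1 gx.2))].
have bR n : baire_property (Rel n).
  apply: (ent_bp gS); first exact: (bm_act (trivial_action G X) bf).
  exact: (bm_act aGP bf).
have /choice[O OP] n : exists O, open O /\ comeager [set gx | Rel n gx <-> O gx].
  by have /baire_propertyP[O] := bR n; exists O.
pose L := [set x | forall n, comeager [set g | Rel n (g, x) <-> O n (g, x)]].
have cL : comeager L.
  by apply: comeager_forall => n; exact: kuratowski_ulam BGP (OP n).2.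
(* [D (n, j)]: the section of [O n] at [x] is dense in [BG j]. *)
pose D (p : nat * nat) := [set x | forall i, BG i !=set0 -> BG i `<=` BG p.2 ->
  exists2 g, BG i g & O p.1 (g, x)].
have bD p : baire_property (D p).
  apply: bp_forall => i; apply: bp_imp; first exact: bp_cst.
  apply: bp_imp; first exact: bp_cst.
  by apply: bp_open; apply: open_proj2; have [] := OP p.1.
have DR n j x : L x -> D (n, j) x -> comeager [set g | BG j g -> Rel n (g, x)].
  move=> /(_ n) Lx Dx; have oO := open_section1 x (OP n).1.
  apply: (comeager2 Lx (comeager_imp_open (BGP.1 j) oO _)); last first.
    by move=> g /= RO OR /OR/RO.
  move=> W oW [g Wg] Wj; have [i Big BW] := BGP.2 _ _ oW Wg.
  have [||h Bh Oh] := Dx i; [by exists g|by move=> ? /BW /Wj|].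
  by exists h; split=> //; exact: BW.
have RD n x W : L x -> open W -> W 1%g ->
    comeager [set g | W g -> Rel n (g, x)] -> exists j, BG j 1%g /\ D (n, j) x.
  move=> /(_ n) Lx oW W1 cW; have [j Bj1 BW] := BGP.2 _ _ oW W1.
  exists j; split=> // i Bi0 Bij.
  have [g Bg [/= RO WR]] := baire_spaceP bG (comeagerI Lx cW) (BGP.1 i) Bi0.
  by exists g => //; apply/RO/WR/BW/Bij.
(* By [close_on_orbit] every nonempty open set contains a translate [g x] of a
generic [x] that belongs to the set; the Baire property makes it comeager. *)
have cD n : comeager [set x | exists j, BG j 1%g /\ D (n, j) x].
  have /baire_propertyP[U oU cU] :
      baire_property [set x | exists j, BG j 1%g /\ D (n, j) x].
    by apply: bp_exists => j; apply: bp_and; [exact: bp_cst|exact: bD].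
  suff dU : dense U.
    by apply: comeager2 cU (comeager_open oU dU) _ => x /= UD; exact: UD.2.
  move=> W W0 oW.
  have [x Wx [[cUx cLx] bx]] := baire_spaceP bX (comeagerI
    (comeagerI (comeager_orbit cU) (comeager_orbit cL)) bm_orbit) oW W0.
  have c := comeagerI (comeagerI cUx cLx) (close_on_orbit gS bx).
  have [|g Wg [[/= UD Lg] cg]] := baire_spaceP bG c (act_open1 aGP x oW).
    by exists 1%g; rewrite /= (cact1 aGP).
  exists (actG g x); split=> //; apply/UD.
  by have [W' [oW' W'1 cW']] := cg n; apply: RD cW'.
have [C cC CU] := bp_relatively_open bD.
exists [set x | [/\ C x, L x, (forall n, exists j, BG j 1%g /\ D (n, j) x) &
                 stable_at (act := act) (V := V) S (f x)]].
  apply: (comeager2 (comeagerI cC cL) (comeagerI (comeager_forall cD) cS)).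
  by move=> x [Cx Lx] [Dx Sx].
move=> n x0 [Cx0 _ /(_ n.+4)[j [Bj Dj]] _].
have [U oU UP] := CU (n.+4, j).
exists U, (BG j); split=> //; [exact/UP|exact: BGP.1|].
move=> x Ux [Cx Lx _ Sx]; apply: comeagerS (DR n.+4 j _ Lx _) => [g RB /RB /=|].
  have [h fh] := fP g x; rewrite /Rel /= fh => Sh.
  have [v Vv e] := stable_close actP VP pH pY gS Sx Sh.
  by exists v^-1%g; [exact: ib_inv|rewrite [in RHS]e (actK actP)].
exact/(UP _ Cx).
Qed.

End orbits.

(** * Ergodicity along unbalanced paths *)

Section ergodic.
Context {R : realType}.
Context {G : topologicalGroupType} {X : topologicalType} {actG : G -> X -> X}.
Context (aGP : continuous_action actG).
Context {BG : nat -> set G}.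
Context (BGP : countable_base G BG).
Context (bG : baire_space G).
Context {BX : nat -> set X}.
Context (BXP : countable_base X BX).
Context (bX : baire_space X).
Context {H : topologicalGroupType} {Y : topologicalType} {act : H -> Y -> Y}.
Context (actP : continuous_action act).
Context (pH : polish R H) (pY : polish R Y).
Context {V : nat -> set H}.
Context (VP : invariant_base V).
Context {q : nat -> H}.
Context (qP : forall O : set H, open O -> O !=set0 -> exists n, O (q n)).
Context {B : nat -> set Y}.
Context (BP : countable_base Y B).
Context {f : X -> Y}.
Context (bf : baire_measurable f).
Context (fP : forall g x, exists h, f (actG g x) = act h (f x)).

Local Notation entourages := (entourages (act := act) (V := V)).
Local Notation derived_all := (derived_all (act := act) (V := V)).
Local Notation chases := (chases (act := act) (V := V)).

(** Generic ergodicity of [f] for the relation that [S] approximates, at every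
finite precision. *)
Definition ergodic_for (S : system (Y := Y)) := exists2 C, comeager C &
  forall x x', C x -> C x' -> forall n, exists h, S n (f x) (act h (f x')).

Lemma small_cube (W : set G) : open W -> W 1%g ->
  exists W' : set G, [/\ open W', W' 1%g &
    forall g h k, W' g -> W' h -> W' k -> W (g * h * k^-1)%g].
Proof.
move=> oW W1; have [W2 [oW2 W21 W2W]] := small_square oW W1.
have [W3 [oW3 W31 W3W]] := small_square oW2 W21.
exists (W3 `&` [set g | W2 g^-1%g]); split.
- by apply: openI => //; exact: invg_open.
- by split=> //; rewrite /= invg1.
- by move=> g h k [Wg _] [Wh _] [_ Wk]; apply: W2W => //; exact: W3W.
Qed.

(** The closeness required of an unbalanced pair survives small moves of its two
points, which will be used to make them generic. *)
Lemma closure_orbit (W W' : set G) a b g k :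
  (forall g h k, W' g -> W' h -> W' k -> W (g * h * k^-1)%g) ->
  W' g -> W' k -> closure [set actG v b | v in W'] a ->
  forall O, open O -> O (actG g a) -> exists2 v, W v & O (actG v (actG k b)).
Proof.
move=> W'W Wg Wk cl O oO Oa.
have [|_ [[v Wv <-] /= Ov]] := cl [set z | O (actG g z)].
  by apply: open_nbhs_nbhs; split; [exact: (act_open2 aGP g oO)|].
exists (g * v * k^-1)%g; first exact: W'W.
by rewrite -(cactM aGP) mulgVK (cactM aGP).
Qed.

(** If [S] does not distinguish orbits, then countably many translates of a fixed
point [y] come [S]-close to every other point. *)
Lemma ergodic_cover (S : system (Y := Y)) y x n : entourages S ->
  (exists h, S n.+1 y (act h (f x))) -> exists p, S n (act (q p) y) (f x).
Proof.
move=> gS [h Sh].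
have [||p Vp] := qP (O := [set p | V n.+1 (p * h)%g]).
- exact: (mulgr_open h (ib_open VP n.+1)).
- by exists h^-1%g; rewrite /= mulVg; exact: ib_1.
exists p; have := ent_act gS h^-1%g Sh; rewrite (actK actP).
apply: (ent_trans gS); apply: (ent_sym gS).
by rewrite -[q p](mulgK h) (cactM actP (q p * h)%g); exact: (ent_near gS).
Qed.

(** The heart of the proof. Since [f] is generically ergodic for each [S k], the
countably many sets of points [x] with [S k m (q p y) (f x)], for one fixed
[y], cover a comeager set; after discarding a meager set they are open, and
[f] is continuous. So points of the domain that are close have images that are
close both in [Y] and for [S k]. Now an unbalanced pair provides points of the
two orbits, [x1] and [y1], such that small elements of [G] bring [y1]
arbitrarily close to [x1] and conversely; by orbit continuity the image of [y1]
is then moved by small elements of [H], and this is the definition of [chases].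
The same pair serves all [k] simultaneously, which is why countable
intersections are no obstacle. *)
Lemma unbalanced_derived_all (S : nat -> system (Y := Y)) :
  (forall k, entourages (S k)) -> (forall k, ergodic_for (S k)) ->
  exists C, [/\ invariant_set actG C, comeager C &
    forall x y, C x -> C y -> unbalanced actG x y ->
      forall n, exists h, derived_all S n (f x) (act h (f y))].
Proof.
move=> gS eS.
have /choice[E EP] k : exists C, comeager C /\
    forall x x', C x -> C x' -> forall n, exists h, S k n (f x) (act h (f x')).
  by have [C] := eS k; exists C.
have cE : comeager [set x | forall k, E k x].
  by apply: comeager_forall => k; have [] := EP k.
(* The reference point [xs] is generic; there is none only if [X] is empty. *)
have [[xs Exs]|E0] := pselect ([set x | forall k, E k x] !=set0); last first.
  have X0 (x : X) : False.
    have [|z _ Ez] := baire_spaceP bX cE openT; first by exists x.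
    by apply: E0; exists z.
  by exists setT; split; [|exact: comeagerT|move=> x; case: (X0 x)].
pose N (t : nat * nat * nat) := [set x | S t.1.1 t.2 (act (q t.1.2) (f xs)) (f x)].
have bN t : baire_property (N t) by apply: (ent_bp (gS _)) => //; exact: bm_cst.
have [C1 cC1 C1U] := bp_relatively_open bN.
have [C2 cC2 C2U] := bp_relatively_open (fun i => bf (BP.1 i)).
have [C3 cC3 C3U] := orbit_continuity aGP BGP bG BXP bX actP VP qP BP bf fP pH pY.
pose C0 := (C1 `&` C2) `&` (C3 `&` [set x | forall k, E k x]).
have cC0 : comeager C0 by apply: comeagerI; exact: comeagerI.
pose C := [set x | comeager [set g | C0 (actG g x)]].
have iC : invariant_set actG C by move=> g x Cx; exact: (comeager_orbit_act aGP).
have cC : comeager C by exact: (comeager_orbit aGP BGP).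
exists C; split=> // x y Cx Cy xy n.
have [|g0 _ C0g] := comeager_orbitP bG Cx openT; first by exists 1%g.
have [_ [C3g _]] := C0g.
(* [U] and [W] come from a generic point of the orbit of [x] and are fixed
before unbalancedness is invoked for them. *)
have [U [W [oU Ug oW W1 UW]]] := C3U n.+1 _ C3g.
have [W' [oW' W'1 W'W]] := small_cube oW W1.
have [gx [gy [Ux Uy clxy clyx]]] : exists gx gy : G,
      [/\ U (actG gx x), U (actG gy y),
          closure [set actG v (actG gx x) | v in W'] (actG gy y) &
          closure [set actG v (actG gy y) | v in W'] (actG gx x)].
  by apply: xy => //; left; exists (actG g0 x); split=> //; exists g0.
have move z : C z -> U z -> exists g, [/\ W' g, U (actG g z) & C0 (actG g z)].
  move=> Cz Uz.
  have [||g [Wg Ugz] C0z] := comeager_orbitP bG Cz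
    (U := W' `&` [set g | U (actG g z)]).
  - by apply: openI => //; exact: (act_open1 aGP z oU).
  - by exists 1%g; split=> //; rewrite /= (cact1 aGP).
  by exists g.
have [k [Wk Uk C0k]] := move _ (iC gx x Cx) Ux.
have [l [Wl Ul C0l]] := move _ (iC gy y Cy) Uy.
set x1 := actG k (actG gx x) in Uk C0k.
set y1 := actG l (actG gy y) in Ul C0l.
have xy1 : forall O, open O -> O x1 -> exists2 v, W v & O (actG v y1).
  exact: closure_orbit W'W Wk Wl clyx.
have yx1 : forall O, open O -> O y1 -> exists2 v, W v & O (actG v x1).
  exact: closure_orbit W'W Wl Wk clxy.
have ch j a b : C0 a -> C0 b -> C b -> U b ->
    (forall O, open O -> O a -> exists2 v, W v & O (actG v b)) ->
    chases (S j) n.+1 (f a) (f b).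
  move=> [[C1a C2a] [_ Ea]] [_ [C3b _]] Cb Ub ab m O oO Oa.
  have [i Bi BO] := BP.2 _ _ oO Oa.
  have [O1 oO1 O1P] := C2U i.
  have [p Sp] : exists p, S j m.+1 (act (q p) (f xs)) (f a).
    by apply: ergodic_cover (gS j) _; apply: (EP j).2.
  have [O2 oO2 O2P] := C1U (j, p, m.+1).
  have [||g1 Wg1 [O1g1 O2g1]] := ab (O1 `&` O2); first exact: openI.
    by split; [exact/O1P|exact/O2P].
  have [||g [Wg [O1g O2g]] [/= C0g' fg]] := baire_spaceP bG (comeagerI Cb (UW _ Ub C3b))
      (O := W `&` [set g | (O1 `&` O2) (actG g b)]).
  - by apply: openI => //; apply: (act_open1 aGP b); exact: openI.
  - by exists g1.
  have [[C1g C2g] _] := C0g'; have [v Vv fv] := fg Wg.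
  have Bv : B i (f (actG g b)) by exact/(O1P _ C2g).
  have Sv : N (j, p, m.+1) (actG g b) by exact/(O2P _ C1g).
  exists v; rewrite -fv; split=> //; first exact: BO.
  exact: (ent_trans (gS j)) (ent_sym (gS j) Sp) Sv.
have Cx1 : C x1 by apply: (iC); exact: iC.
have Cy1 : C y1 by apply: (iC); exact: iC.
have T1 : derived_all S n (f x1) (f y1).
  have mono j a b : chases (S j) n.+1 a b -> chases (S j) n a b.
    move=> c m O oO Oa; have [v [Vv Ov Sv]] := c m O oO Oa.
    by exists v; split=> //; apply: (ib_mono VP (leqnSn n)).
  move=> j; have cxy := ch j _ _ C0k C0l Cy1 Ul xy1.
  have cyx := ch j _ _ C0l C0k Cx1 Uk yx1.
  split; [|exact: mono|exact: mono].
  have [v [Vv _ Sv]] := cxy n.+1 setT openT I.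
  apply: (ent_trans (gS j)) Sv _; rewrite -{2}[f y1](actK actP v).
  by apply: (ent_near (gS j)); exact: ib_inv.
have [h1 f1] : exists h, f x1 = act h (f x).
  by rewrite /x1 -(cactM aGP); exact: fP.
have [h2 f2] : exists h, f y1 = act h (f y).
  by rewrite /y1 -(cactM aGP); exact: fP.
exists (h1^-1 * h2)%g.
have gT := entourages_derived_all actP VP qP BP gS.
have := ent_act gT h1^-1%g T1.
by rewrite f1 f2 (actK actP) -(cactM actP).
Qed.

(** Systems are transitive up to precision, so edges compose along a path. *)
Lemma ergodic_derived_all (S : nat -> system (Y := Y)) :
  generically_semi_connected actG ->
  (forall k, entourages (S k)) -> (forall k, ergodic_for (S k)) ->
  ergodic_for (derived_all S).
Proof.
move=> conn gS eS; have gT := entourages_derived_all actP VP qP BP gS.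
have [C [iC cC CP]] := unbalanced_derived_all gS eS.
have [D [cD DC DP]] := conn C iC cC.
exists D => // x x' Dx Dx'; have [l [p [l0 <- <- pC pP]]] := DP x x' Dx Dx'.
have h i : (i < l)%N -> forall n, exists h, derived_all S n (f (p 0%N)) (act h (f (p i))).
  elim: i => [|i IH] il n.
    by exists 1%g; rewrite (cact1 actP); exact: (ent_refl actP VP _ _ gT).
  have [h1 T1] := IH (ltnW il) n.+1.
  have [h2 T2] := CP _ _ (pC i (ltnW il)) (pC _ il) (pP i.+1 il) n.+1.
  exists (h1 * h2)%g; rewrite (cactM actP).
  by apply: (ent_trans gT) T1 _; exact: (ent_act gT).
by apply: h; rewrite prednK.
Qed.

(** For a system that is stable and for which [f] is generically ergodic, some
translate [h k (f x')] is close to [f x] to precision [k], in [Y] and for [S].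
Successive translates are then [S]-close to each other within one orbit, hence
differ by small elements of [H] by stability; so they converge inside the
orbit, and their limit is [f x]. *)
Lemma generic_orbit : generically_semi_connected actG ->
  exists2 C, comeager C & forall x x', C x -> C x' ->
    exists h, f x = act h (f x').
Proof.
move=> conn.
have [|||S [gS eS] cS] := stabilization actP VP qP bX BXP bf
  (K := fun S => entourages S /\ ergodic_for S).
- by move=> S [].
- move=> S gS; split.
    by apply: (entourages_derived_all actP VP qP BP) => k; have [] := gS k.
  by apply: ergodic_derived_all => // k; have [] := gS k.
- exists (fun _ _ _ => True); split; first exact: trivial_entourages.
  by exists setT; [exact: comeagerT|move=> *; exists 1%g].
have [C cC CP] := ergodic_derived_all conn (fun _ : nat => gS) (fun=> eS).
exists (C `&` [set x | stable_at (act := act) (V := V) S (f x)]); first exact: comeagerI.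
move=> x x' [Cx _] [Cx' Sx'].
have [_ [d dP _]] := pY; have [U [UP Ulim]] := neighbourhood_sequence dP (f x).
(* Precision 7: one unit for transitivity, four for [stable_close], two for
[chain_limit]. *)
have /choice[h hP] k : exists h, S (k + 7)%N (f x) (act h (f x')) /\ U k (act h (f x')).
  have [h /(_ 0%N)[_ ch _]] := CP x x' Cx Cx' 0%N; have [oU Ux] := UP k.
  have [v [_ Uv Sv]] := ch (k + 7)%N _ oU Ux.
  by exists (v * h)%g; rewrite (cactM actP).
have [||v _ ->] := chain_limit actP (n := 0)
  (y_ := fun k => act (h k) (f x')) (y := f x) pH pY VP.
- move=> k; rewrite add0n.
  have [Sk _] := hP k; have [Sk1 _] := hP k.+1.
  have Sk' : S k.+2.+4 (act (h k) (f x')) (act (h k.+1) (f x')).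
    rewrite addnC in Sk; apply: (ent_trans gS) (ent_sym gS Sk) _.
    by apply: (ent_mono actP VP gS) Sk1; rewrite addnC.
  have := ent_act gS (h k)^-1%g Sk'; rewrite (actK actP) -(cactM actP).
  move=> /(stable_close actP VP pH pY gS Sx')[w Vw xw].
  exists (h k * w^-1 * (h k)^-1)%g; first by apply: ib_conj => //; exact: ib_inv.
  rewrite {2}xw -!(cactM actP); congr (act _ _).
  by rewrite -!mulgA mulKg mulKg mulVKg.
- by apply: Ulim => k; have [] := hP k.
by exists (v * h 0%N)%g; rewrite (cactM actP).
Qed.

End ergodic.

Theorem theorem1p3 (R : realType)
    (G : topologicalGroupType) (polishG : polish R G)
    (X : topologicalType) (polishX : polish R X)
    (actG : G -> X -> X) (actGP : continuous_action actG)
    (H : topologicalGroupType) (polishH : polish R H) (tsiH : tsi R H)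
    (Y : topologicalType) (polishY : polish R Y)
    (actH : H -> Y -> Y) (actHP : continuous_action actH) :
  generically_semi_connected actG ->
  generically_ergodic (orbit_eqrel actG) (orbit_eqrel actH).
Proof.
move=> conn f bf hf.
have [BG BGP] := polish_base polishG.
have [BX BXP] := polish_base polishX.
have [B BP] := polish_base polishY.
have [V VP] := tsi_invariant_base tsiH.
have [q qP] := polish_dense_sequence polishH 1%g.
have fP g x : exists h, f (actG g x) = actH h (f x).
  by apply/(orbit_eqrelP actHP)/hf/(orbit_eqrelP actGP); exists g.
have [C cC CP] := generic_orbit actGP BGP (polish_baire polishG) BXP
  (polish_baire polishX) actHP polishH polishY VP qP BP bf fP conn.
exists C => // x x' Cx Cx'; apply/(orbit_eqrelP actHP); exact: CP.
Qed.
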